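(* The following two statements hold: (i) A graph $G$ is $3P_1$-pivot-minor-free if and only if it is $(3P_1, W_4, \overline{BW_3})$-free. (ii) A graph $G$ is $K_{1,3}$-pivot-minor-free if and only if it is $(K_{1,3}, P_5, \text{bull}, W_4, \overline{BW_3})$-free.
   Context: Graphs are finite, without loops or multiple edges. $3P_1$ is the graph with three vertices and no edges; $K_{1,3}$ is the star with three leaves; $P_5$ is the path on five vertices; the bull is obtained from $P_5$ by adding an edge between its second and fourth vertices; $W_4$ is obtained from the 4-cycle $C_4$ by adding one vertex adjacent to all vertices of the cycle. $BW_3$ is the seven-vertex graph obtained from the 6-cycle $C_6$ by adding one vertex adjacent to three pairwise non-adjacent vertices of the cycle, and $\overline{BW_3}$ is its complement (equivalently: a clique $\{a_1,a_2,a_3\}$ and a clique $\{b_1,b_2,b_3,b_4\}$, with exactly the edges $a_1b_1,a_2b_2,a_3b_3$ between them). A graph is $(H_1,\dots,H_p)$-free if it has no induced subgraph isomorphic to any $H_i$. For a vertex $u$ of a graph $G$, the local complementation $G*u$ is obtained from $G$ by complementing the adjacency between every pair of distinct neighbours of $u$. For an edge $uv$ of $G$, the edge pivot is $G\wedge uv=((G*u)*v)*u$. A graph $G$ contains $H$ as a pivot-minor if $H$ can be obtained from $G$ by a sequence of vertex deletions and edge pivots; $G$ is $H$-pivot-minor-free if it contains no pivot-minor isomorphic to $H$. *)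

(* Defs.v *)
From mathcomp Require Import all_boot.

Set Implicit Arguments.
Unset Strict Implicit.
Unset Printing Implicit Defensive.

Record sgraph := SGraph {
  vertex :> finType;
  adj : rel vertex;
  adj_sym : symmetric adj;
  adj_irr : irreflexive adj }.

Definition graph_iso (G H : sgraph) : Prop :=
  exists2 f : G -> H, bijective f & forall x y, adj (f x) (f y) = adj x y.

(* The symmetric irreflexive closure of [e] as a graph; for an [e] that is
   already symmetric, the only effect is to discard loops. *)
Section OfRel.
Variables (T : finType) (e : rel T).

Definition of_rel_adj : rel T := fun x y => (x != y) && (e x y || e y x).

Lemma of_rel_sym : symmetric of_rel_adj.
Proof. by move=> x y; rewrite /of_rel_adj eq_sym orbC. Qed.

Lemma of_rel_irr : irreflexive of_rel_adj.
Proof. by move=> x; rewrite /of_rel_adj eqxx. Qed.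

Definition of_rel : sgraph := SGraph of_rel_sym of_rel_irr.
End OfRel.

Section Operations.
Variable G : sgraph.

Definition induced (S : {set G}) : sgraph :=
  of_rel (fun x y : {x : G | x \in S} => adj (val x) (val y)).

Definition delete_vertex (v : G) : sgraph := induced [set~ v].

Definition compl_graph : sgraph := of_rel (fun x y : G => ~~ adj x y).

Definition add_vertex (N : pred G) : sgraph :=
  of_rel (fun x y : option G =>
    match x, y with
    | Some a, Some b => adj a b
    | None, Some b => N b
    | _, None => false
    end).

Definition local_adj (u : G) : rel G :=
  fun x y => (x != y) && (adj x y (+) (adj u x && adj u y)).

Lemma local_sym u : symmetric (local_adj u).
Proof. by move=> x y; rewrite /local_adj eq_sym adj_sym [adj u x && _]andbC. Qed.

Lemma local_irr u : irreflexive (local_adj u).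
Proof. by move=> x; rewrite /local_adj eqxx. Qed.

(* Kept on the vertex type of [G], so that complementations at successive
   vertices of [G] compose. *)
Definition local_compl (u : G) : sgraph :=
  SGraph (@local_sym u) (@local_irr u).
End Operations.

Definition pivot (G : sgraph) (u v : G) : sgraph :=
  @local_compl (@local_compl (@local_compl G u) v) u.

Inductive pivot_reachable (G : sgraph) : sgraph -> Prop :=
| PivotRefl : pivot_reachable G G
| PivotDelete (H : sgraph) (v : H) :
    pivot_reachable G H -> pivot_reachable G (delete_vertex v)
| PivotEdge (H : sgraph) (u v : H) :
    pivot_reachable G H -> adj u v -> pivot_reachable G (pivot u v).

Definition has_pivot_minor (H G : sgraph) : Prop :=
  exists2 K, pivot_reachable G K & graph_iso K H.

Definition pivot_minor_free (H G : sgraph) : Prop := ~ has_pivot_minor H G.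

Definition has_induced (H G : sgraph) : Prop :=
  exists S : {set G}, graph_iso (induced S) H.

Definition induced_free (H G : sgraph) : Prop := ~ has_induced H G.

Definition edgeless (n : nat) : sgraph := of_rel (fun _ _ : 'I_n => false).

Definition path_graph (n : nat) : sgraph :=
  of_rel (fun i j : 'I_n => j == i.+1 :> nat).

Definition cycle_graph (n : nat) : sgraph :=
  of_rel (fun i j : 'I_n => j == ordS i).

Definition threeP1 : sgraph := edgeless 3.

Definition K13 : sgraph := @add_vertex (edgeless 3) predT.

Definition P5 : sgraph := path_graph 5.

(* Vertices are numbered from 0: 1 and 3 are the second and fourth. *)
Definition bull : sgraph :=
  of_rel (fun i j : P5 =>
    adj i j || (val (i : 'I_5) == 1) && (val (j : 'I_5) == 3)).

Definition W4 : sgraph := @add_vertex (cycle_graph 4) predT.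

Definition BW3 : sgraph :=
  @add_vertex (cycle_graph 6) (fun i : 'I_6 => ~~ odd i).

Definition coBW3 : sgraph := compl_graph BW3.

(* Main.v *)
(* Pivoting an edge twice restores the graph. So, to see that freeness from the
   obstructions survives a pivot at uv, it suffices that pivoting uv in any
   graph containing an obstruction E produces a graph containing one; only the
   subgraph induced by E together with u and v matters, hence this is a check
   on graphs with at most |E| + 2 <= 9 vertices. Taking the obstructions in
   increasing size and discarding the graphs that already contain an earlier
   one leaves few cases. Conversely each obstruction has 3P_1 (resp. K_{1,3})
   as a pivot-minor through at most two explicit pivots. *)

Require Import Defs.
From mathcomp Require Import all_boot.

Set Implicit Arguments.
Unset Strict Implicit.
Unset Printing Implicit Defensive.

(** * Pivoting a relation *)

(** Convertible to [local_adj] on a graph, but usable on matrices over [nat] as well. *)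
Definition lc (T : eqType) (a : rel T) (u : T) : rel T :=
  fun x y => (x != y) && (a x y (+) (a u x && a u y)).

Definition piv (T : eqType) (a : rel T) (u v : T) : rel T :=
  lc (lc (lc a u) v) u.

Lemma eq_lc (T : eqType) (a b : rel T) u : a =2 b -> lc a u =2 lc b u.
Proof. by move=> ab x y; rewrite /lc !ab. Qed.

Lemma lc_irr (T : eqType) (a : rel T) u : irreflexive (lc a u).
Proof. by move=> x; rewrite /lc eqxx. Qed.

Lemma lc_sym (T : eqType) (a : rel T) u : symmetric a -> symmetric (lc a u).
Proof. by move=> sa x y; rewrite /lc eq_sym sa [a u x && _]andbC. Qed.

Lemma lcl (T : eqType) (a : rel T) u x : irreflexive a -> lc a u u x = a u x.
Proof. by move=> ia; rewrite /lc ia addbF; case: eqP => // <-; rewrite ia. Qed.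

(** The first complementation leaves the neighbourhood of [u] unchanged, so the second toggles the
    same pairs again. *)
Lemma lcK (T : eqType) (a : rel T) u : irreflexive a -> lc (lc a u) u =2 a.
Proof.
move=> ia x y; rewrite {1}/lc !lcl // /lc.
by case: eqP => [->|_] /=; rewrite ?ia // addbK.
Qed.

(** The word [u v u] is a palindrome, so the two pivots cancel letter by letter from the middle. *)
Lemma pivK (T : eqType) (a : rel T) u v :
  irreflexive a -> piv (piv a u v) u v =2 a.
Proof.
move=> ia x y; rewrite /piv -[RHS](lcK u ia); apply: eq_lc => {}x {}y.
rewrite -[RHS](lcK v (lc_irr a u)); apply: eq_lc => {}x {}y.
exact/lcK/lc_irr.
Qed.

Lemma piv_edge (T : eqType) (a : rel T) u v :
  symmetric a -> irreflexive a -> piv a u v u v = a u v.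
Proof.
move=> sa ia; rewrite /piv lcl; last exact: lc_irr.
have su := lc_sym u sa; have iu := lc_irr a u.
by rewrite (lc_sym v su) lcl // su lcl.
Qed.

(** * Copies of adjacency matrices *)

(** Positions are plain numbers, of which only those below [n] count, so matrices can grow and be
    evaluated without ordinals. *)
Definition copy (T : Type) (a : rel T) (n : nat) (e : rel nat) (f : nat -> T) :=
  {in gtn n &, injective f} /\
  (forall i j, i < n -> j < n -> a (f i) (f j) = e i j).

Definition lookup (M : seq bitseq) : rel nat :=
  fun i j => nth false (nth [::] M i) j.

Definition tab (n : nat) (e : rel nat) : seq bitseq :=
  mkseq (fun i => mkseq (e i) n) n.

Lemma size_tab n e : size (tab n e) = n.
Proof. exact: size_mkseq. Qed.

Lemma lookup_tab n e i j : i < n -> j < n -> lookup (tab n e) i j = e i j.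
Proof. by move=> ltin ltjn; rewrite /lookup !nth_mkseq. Qed.

Definition contains (T : Type) (a : rel T) (M : seq bitseq) :=
  exists f, copy a (size M) (lookup M) f.

Lemma eq_contains (T : Type) (a b : rel T) M :
  a =2 b -> contains a M -> contains b M.
Proof.
by move=> ab [f [fI fE]]; exists f; split=> // i j lti ltj; rewrite -ab fE.
Qed.

Lemma copy_tab (T : Type) (a : rel T) n e f :
  copy a n e f -> copy a n (lookup (tab n e)) f.
Proof. by case=> fI fE; split=> // i j lti ltj; rewrite lookup_tab ?fE. Qed.

Lemma copy_lc (T : eqType) (a : rel T) n e f u :
  u < n -> copy a n e f -> copy (lc a (f u)) n (lc e u) f.
Proof.
move=> ltu [fI fE]; split=> // i j lti ltj.
by rewrite /lc !fE // (inj_in_eq fI).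
Qed.

(** Tabulating after each complementation keeps the relation as data rather than as nested
    closures. *)
Definition lct n (M : seq bitseq) u := tab n (lc (lookup M) u).

Definition pivt n (M : seq bitseq) u v := lct n (lct n (lct n M u) v) u.

Lemma copy_pivt (T : eqType) (a : rel T) n M f u v :
  u < n -> v < n -> copy a n (lookup M) f ->
  copy (piv a (f u) (f v)) n (lookup (pivt n M u v)) f.
Proof. by move=> ltu ltv cf; do 3!apply/copy_tab/copy_lc=> //. Qed.

(* Adds vertex [n], whose adjacency to the vertices below [n] is read in [b]. *)
Definition extend n (M : seq bitseq) (b : bitseq) : seq bitseq :=
  tab n.+1 (fun i j =>
    if i == n then (j != n) && nth false b j
    else if j == n then nth false b i else lookup M i j).

(** The new row is read off from [a], so enumerating all bit rows covers every one-vertex extension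
    of a copy. *)
Lemma copy_extend (T : eqType) (a : rel T) n M f u :
  symmetric a -> irreflexive a -> (forall i, i < n -> f i != u) ->
  copy a n (lookup M) f ->
  copy a n.+1 (lookup (extend n M (mkseq (fun i => a u (f i)) n)))
       (fun i => if i == n then u else f i).
Proof.
move=> sa ia fu [fI fE]; apply: copy_tab; split=> [i j|i j].
  rewrite !inE !ltnS (leq_eqVlt i) (leq_eqVlt j) => /predU1P[->|lti] /predU1P[->|ltj] //.
  - by rewrite eqxx ltn_eqF // => /esym/eqP; rewrite (negPf (fu j ltj)).
  - by rewrite eqxx ltn_eqF // => /eqP; rewrite (negPf (fu i lti)).
  - by rewrite !ltn_eqF //; apply: fI.
rewrite !ltnS (leq_eqVlt i) (leq_eqVlt j) => /predU1P[->|lti] /predU1P[->|ltj].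
- by rewrite eqxx ia.
- by rewrite eqxx ltn_eqF // nth_mkseq.
- by rewrite eqxx ltn_eqF // nth_mkseq // sa.
- by rewrite !ltn_eqF // fE.
Qed.

(** * Decision procedures *)

(* [has] with a short-circuit under call-by-value. *)
Fixpoint anyb (T : Type) (p : pred T) (s : seq T) : bool :=
  if s is x :: s' then if p x then true else anyb p s' else false.

Lemma anybE (T : Type) (p : pred T) s : anyb p s = has p s.
Proof. by elim: s => //= x s ->. Qed.

(* The pruning is heuristic only: every answer is verified in full at a leaf. *)
Fixpoint search (E M : seq bitseq) n k (s : seq nat) : bool :=
  if k is k'.+1 then
    anyb (fun x =>
      if x \in s then false
      else if [seq lookup M x y | y <- s] == take (size s) (nth [::] E (size s))
      then search E M n k' (rcons s x) else false) (iota 0 n)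
  else [&& uniq s, size s == size E, all (gtn n) s &
    all (fun i => all (fun j =>
      lookup M (nth 0 s i) (nth 0 s j) == lookup E i j)
      (iota 0 (size E))) (iota 0 (size E))].

Definition found (M : seq bitseq) n (E : seq bitseq) :=
  search E M n (size E) [::].

Lemma all_iotaP n (p : pred nat) :
  reflect (forall i, i < n -> p i) (all p (iota 0 n)).
Proof.
by apply: (iffP allP) => pn i; [move=> lti | rewrite mem_iota => lti];
  apply: pn; rewrite ?mem_iota.
Qed.

Lemma searchP E M n k s :
  search E M n k s ->
  exists2 g : nat -> nat, (forall i, i < size E -> g i < n)
    & copy (lookup M) (size E) (lookup E) g.
Proof.
elim: k s => [|k IHk] s /=; last first.
  rewrite anybE => /hasP[x _]; case: ifP => // _; case: ifP => // _; exact: IHk.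
case/and4P=> us /eqP szs /allP sn /all_iotaP sE; exists (nth 0 s).
  by move=> i lti; apply/sn/mem_nth; rewrite szs.
split=> [i j|i j lti ltj]; last by have /all_iotaP/(_ j ltj)/eqP := sE i lti.
by rewrite !inE -szs => lti ltj /eqP; rewrite nth_uniq // => /eqP.
Qed.

(** Soundness of the search suffices: a missed copy could only make [check] or a certificate
    fail. *)
Lemma found_contains (T : Type) (a : rel T) n M f E :
  copy a n (lookup M) f -> found M n E -> contains a E.
Proof.
move=> [fI fE] /searchP[g gn [gI gE]]; exists (f \o g).
split=> [i j lti ltj /fI/gI-> //|i j lti ltj /=]; rewrite ?inE ?gn //.
by rewrite fE ?gn // gE.
Qed.

(** Written with a continuation, so that the list of all rows is never built. *)
Fixpoint allbits n (P : bitseq -> bool) : bool :=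
  if n is n'.+1 then
    allbits n' (fun b => P (true :: b)) && allbits n' (fun b => P (false :: b))
  else P [::].

Lemma allbitsP n P : allbits n P -> forall b, size b = n -> P b.
Proof.
elim: n P => [|n IHn] P /= => [P0 [] // | /andP[Pt Pf] [|[] b] //= [sb]].
- exact: (IHn _ Pt).
- exact: (IHn _ Pf).
Qed.

(** * Survival of freeness under one pivot *)

Section Check.
Variable fam : seq (seq bitseq).

Definition good n M u v := anyb (found (pivt n M u v) n) fam.

(** Either end of the pivot edge may be the one outside the copy; testing both orders replaces a
    proof that the pivot is symmetric in its ends. *)
Definition good_sym n M u v := good n M u v && good n M v u.

(* Pivoting any edge of a graph that contains [E] but no member of [prev]
   leads to a graph that contains a member of [fam]. The three parts are for
   pivot edges with no, one and two ends outside the copy of [E]. *)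
Definition check (prev : seq (seq bitseq)) (E : seq bitseq) : bool :=
  let h := size E in
  let skip n M := anyb (found M n) prev in
  all (fun i => all (fun j => if lookup E i j then good h E i j else true)
                    (iota 0 h)) (iota 0 h) &&
  allbits h (fun b =>
    let M := extend h E b in
    if skip h.+1 M then true else
    all (fun j => if lookup M h j then good_sym h.+1 M h j else true)
        (iota 0 h) &&
    allbits h (fun c =>
      let N := extend h.+1 M (rcons c true) in
      if skip h.+2 N then true else good h.+2 N h h.+1)).

Definition family_free (T : Type) (a : rel T) (F : seq (seq bitseq)) :=
  forall E, E \in F -> ~ contains a E.

Variables (T : eqType) (a : rel T) (u v : T).
Hypotheses (sa : symmetric a) (ia : irreflexive a) (auv : a u v).

Lemma good_free n M f i j :
  copy a n (lookup M) f -> i < n -> j < n -> f i = u -> f j = v ->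
  good n M i j -> ~ family_free (piv a u v) fam.
Proof.
move=> cf lti ltj <- <-; rewrite /good anybE => /hasP[E famE Ef] /(_ E famE).
by apply; apply: found_contains Ef; apply: copy_pivt.
Qed.

Lemma skip_free n M f prev :
  copy a n (lookup M) f -> family_free a prev -> anyb (found M n) prev = false.
Proof.
move=> cf frp; rewrite anybE; apply/hasP=> -[E prevE Ef].
exact/(frp E prevE)/(found_contains cf).
Qed.

Lemma fresh_or (f : nat -> T) n x :
  (exists2 i, i < n & f i = x) \/ (forall i, i < n -> f i != x).
Proof.
have [/hasP[i]|/hasPn fx] := boolP (has (fun i => f i == x) (iota 0 n)).
  by rewrite mem_iota => lti /eqP; left; exists i.
by right=> i lti; apply: fx; rewrite mem_iota.
Qed.

(** A copy of [E], enlarged by [u] and [v], would be one of the enumerated matrices; it is not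
    skipped because [a] is free of [prev], so its pivot would contain a member of [fam]. *)
Lemma check_free prev E :
  check prev E -> family_free a prev -> family_free (piv a u v) fam ->
  ~ contains a E.
Proof.
rewrite /check; set h := size E.
move=> /andP[/all_iotaP chk0 /allbitsP chk] frp frf [f cf]; move: (cf) => [fI fE].
(* Adding one outside vertex [x] at position [h] serves all three cases in which some end of the
   pivot edge lies outside the copy. *)
have one x : (forall i, i < h -> f i != x) -> exists M f1,
    [/\ [/\ copy a h.+1 (lookup M) f1, f1 h = x & forall i, i < h -> f1 i = f i],
        forall j, j < h -> lookup M h j -> good_sym h.+1 M h j
      & allbits h (fun c =>
          let N := extend h.+1 M (rcons c true) in
          if anyb (found N h.+2) prev then true else good h.+2 N h h.+1)].
  move=> fx; set b := mkseq (fun i => a x (f i)) h.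
  have cf1 := copy_extend sa ia fx cf; rewrite -/b in cf1.
  have := chk b (size_mkseq _ _); rewrite /= (skip_free cf1 frp).
  case/andP=> /all_iotaP chk1 chk2.
  exists (extend h E b), (fun i => if i == h then x else f i); split=> //.
    by split=> //; rewrite ?eqxx // => i lti; rewrite ltn_eqF.
  by move=> j ltj Mj; have := chk1 j ltj; rewrite Mj.
have [[i lti fi]|fu] := fresh_or f h u; have [[j ltj fj]|fv] := fresh_or f h v.
- apply: (good_free cf lti ltj fi fj _ frf).
  by have /all_iotaP/(_ j ltj) := chk0 i lti; rewrite -fE // fi fj auv.
- have [M [f1 [[cf1 f1h f1E] chk1 _]]] := one v fv.
  have f1i : f1 i = u by rewrite f1E.
  apply: (good_free cf1 (leqW lti) (ltnSn h) f1i f1h _ frf).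
  case: cf1 => _ f1M; have := chk1 i lti.
  by rewrite -(f1M h i (ltnSn h) (leqW lti)) f1h f1i sa auv => /(_ isT)/andP[].
- have [M [f1 [[cf1 f1h f1E] chk1 _]]] := one u fu.
  have f1j : f1 j = v by rewrite f1E.
  apply: (good_free cf1 (ltnSn h) (leqW ltj) f1h f1j _ frf).
  case: cf1 => _ f1M; have := chk1 j ltj.
  by rewrite -(f1M h j (ltnSn h) (leqW ltj)) f1h f1j auv => /(_ isT)/andP[].
(* Both ends are outside: [u] takes position [h] and [v] position [h.+1]. *)
have [M [f1 [[cf1 f1h f1E] _ /allbitsP chk2]]] := one u fu.
have f1v i : i < h.+1 -> f1 i != v.
  rewrite ltnS leq_eqVlt => /predU1P[->|lti]; last by rewrite f1E ?fv.
  by rewrite f1h; apply: contraTneq auv => ->; rewrite ia.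
have cf2 := copy_extend sa ia f1v cf1.
(* The last bit in the row of [v] is its adjacency to [u], hence the [rcons c true] in [check]. *)
rewrite mkseqS f1h sa auv in cf2.
have := chk2 _ (size_mkseq (fun i => a v (f1 i)) h).
rewrite /= (skip_free cf2 frp).
move=> gd; apply: (good_free cf2 _ _ _ _ gd frf) => //=.
  by rewrite ltn_eqF.
by rewrite eqxx.
Qed.

Fixpoint chain prev rest : bool :=
  if rest is E :: rest' then check prev E && chain (rcons prev E) rest' else true.

(** Obstructions are excluded from [a] one at a time; each joins [prev] and so prunes the checks of
    the later ones. *)
Lemma chain_free prev rest :
  chain prev rest -> family_free (piv a u v) fam -> family_free a prev ->
  family_free a (prev ++ rest).
Proof.
move=> + frf; elim: rest prev => [|E rest IHr] prev /=; first by rewrite cats0.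
case/andP=> chk chn frp; rewrite -cat_rcons; apply: IHr => // E'.
rewrite mem_rcons inE => /predU1P[->|/frp //]; exact: check_free chk frp frf.
Qed.

End Check.

(** * Graphs given by adjacency matrices *)

Definition numbering (T : Type) n (enc : T -> nat) :=
  exists dec, [/\ cancel enc dec, forall x, enc x < n
    & forall i, i < n -> enc (dec i) = i].

(** Moves a graph built on ordinals and options to a relation on [nat], where the checks can be
    evaluated. *)
Definition numbered (H : sgraph) n (e : rel nat) (enc : H -> nat) :=
  numbering n enc /\ forall x y : H, adj x y = e (enc x) (enc y).

Lemma graph_iso_sym G H : graph_iso G H -> graph_iso H G.
Proof.
by case=> f [g fK gK] fE; exists g => [|x y]; [exists f | rewrite -fE !gK].
Qed.

Lemma numbered_containsP (H G : sgraph) n e (enc : H -> nat) :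
  numbered n e enc ->
  contains (@adj G) (tab n e) <->
  exists2 f : H -> G, injective f & forall x y, adj (f x) (f y) = adj x y.
Proof.
move=> [[dec [encK encn decK]] eE]; rewrite /contains size_tab.
split=> [[f [fI fE]]|[f fI fE]].
  exists (f \o enc) => [x y|x y] /=; last by rewrite fE // lookup_tab ?eE.
  by move/fI => /(_ (encn x) (encn y))/(can_inj encK).
exists (f \o dec); apply: copy_tab; split=> [i j lti ltj /fI eqd|i j lti ltj /=].
  by rewrite -(decK i) // eqd decK.
by rewrite fE eE !decK.
Qed.

Lemma adj_induced (G : sgraph) (S : {set G}) (x y : induced S) :
  adj x y = adj (val x) (val y).
Proof.
rewrite /= /of_rel_adj (adj_sym (val y)) orbb; case: eqP => // ->.
by rewrite adj_irr.
Qed.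

Lemma has_inducedP (H G : sgraph) :
  has_induced H G <->
  exists2 f : H -> G, injective f & forall x y, adj (f x) (f y) = adj x y.
Proof.
split=> [[S /graph_iso_sym[g /bij_inj gI gE]]|[f fI fE]].
  exists (fun x => val (g x)) => [x y /val_inj/gI //|x y].
  by rewrite -adj_induced gE.
exists [set f x | x : H]; apply: graph_iso_sym.
pose g x : induced [set f x | x : H] := exist _ (f x) (imset_f f isT).
have gI : injective g by move=> x y /(congr1 val)/fI.
exists g => [|x y]; last by rewrite adj_induced /= fE.
by apply: inj_card_bij gI _; rewrite card_sig card_imset.
Qed.

(** * Pivot-minors from embeddings and pivot sequences *)

Lemma has_pivot_minor_trans (H K G : sgraph) :
  pivot_reachable G K -> has_pivot_minor H K -> has_pivot_minor H G.
Proof.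
move=> GK [L KL LH]; exists L => // {LH}.
elim: KL => [|L' w _|L' w w' _]; [exact: GK|exact: PivotDelete|exact: PivotEdge].
Qed.

(** By induction on the order of [G]: delete a vertex missed by [f] until [f] is onto, hence an
    isomorphism. *)
Lemma embedding_pivot_minor (H G : sgraph) (f : H -> G) :
  injective f -> (forall x y, adj (f x) (f y) = adj x y) -> has_pivot_minor H G.
Proof.
have [n leGn] := ubnP #|G|; elim: n G leGn f => // n IHn G leGn f fI fE.
have [/forallP fS|] := boolP [forall v, v \in codom f].
  exists G; first exact: PivotRefl.
  apply: graph_iso_sym; exists f => //; apply: inj_card_bij => //.
  by rewrite -(card_codom fI); apply/subset_leq_card/subsetP=> v _; apply: fS.
rewrite negb_forall => /existsP[v fv].
have fP x : f x \in [set~ v].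
  by rewrite !inE; apply: contraNneq fv => <-; apply: codom_f.
pose g x : delete_vertex v := exist _ (f x) (fP x).
apply: has_pivot_minor_trans (PivotDelete v (PivotRefl G)) _.
apply: (IHn _ _ g) => [|x y /(congr1 val)/fI //|x y].
  rewrite card_sig cardsC1.
  (* The vertex [v] makes [#|G|] positive, so its predecessor is strictly smaller. *)
  by case: #|G| leGn (max_card (pred1 v)) => //; rewrite card1.
by rewrite adj_induced fE.
Qed.

(** Pivots come first; all vertex deletions are left to the final search for an induced copy. *)
Fixpoint reaches n M (es : seq (nat * nat)) (E : seq bitseq) : bool :=
  if es is (u, v) :: es' then
    [&& u < n, v < n, lookup M u v & reaches n (pivt n M u v) es' E]
  else found M n E.

Lemma reaches_pivot_minor (H G : sgraph) k e (enc : H -> nat) n M es f :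
  numbered k e enc -> copy (@adj G) n (lookup M) f ->
  reaches n M es (tab k e) -> has_pivot_minor H G.
Proof.
move=> He; elim: es G M f => [|[u v] es IHes] G M f cf /=.
  move/(found_contains cf)/(numbered_containsP G He) => [g gI gE].
  exact: embedding_pivot_minor gI gE.
case/and4P=> ltu ltv Muv /(IHes (pivot (f u) (f v)) _ _ (copy_pivt ltu ltv cf)).
apply/has_pivot_minor_trans/PivotEdge; first exact: PivotRefl.
by case: cf => _ ->.
Qed.

Lemma family_free_reachable (fam : seq (seq bitseq)) (G K : sgraph) :
  chain fam [::] fam -> pivot_reachable G K ->
  family_free (@adj G) fam -> family_free (@adj K) fam.
Proof.
move=> chn; elim=> [//|K' v _ IHK /IHK frK'|K' u v _ IHK uv /IHK frK'].
  move=> E /frK' nE [f [fI fE]]; apply: nE; exists (fun i => val (f i)).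
  by split=> [i j lti ltj /val_inj|i j lti ltj]; [apply: fI | rewrite -adj_induced fE].
have sa : symmetric (piv (@adj K') u v) by do 3!apply: lc_sym; apply: adj_sym.
have auv : piv (@adj K') u v u v by rewrite piv_edge //; [apply: adj_sym|apply: adj_irr].
(* [chain_free] pulls freeness back along a pivot, so it is applied to the pivoted graph, whose
   pivot at the same edge is [K'] again. *)
apply: (chain_free sa (lc_irr _ _) auv chn) => // E /frK' nE.
by move/(eq_contains (pivK u v (@adj_irr K'))).
Qed.

(** Certificates make [H] a pivot-minor of every obstruction; conversely freeness passes to all
    reachable graphs, and [H] is itself an obstruction. *)
Theorem pivot_minor_free_family (H : sgraph) k e (enc : H -> nat) fam ess :
  numbered k e enc -> tab k e \in fam -> chain fam [::] fam ->
  all (fun E => has (fun es => reaches (size E) E es (tab k e)) ess) fam ->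
  forall G, pivot_minor_free H G <-> family_free (@adj G) fam.
Proof.
move=> He famH chn /allP cert G; split=> [frH E famE [f cf]|frG [K GK KH]].
  have /hasP[es _] := cert E famE; move/(reaches_pivot_minor He cf); exact: frH.
apply: (family_free_reachable chn GK frG famH).
apply/(numbered_containsP K He); have [g gB gE] := graph_iso_sym KH.
by exists g => //; apply: bij_inj.
Qed.

Lemma induced_freeP (H G : sgraph) n e (enc : H -> nat) :
  numbered n e enc -> induced_free H G <-> ~ contains (@adj G) (tab n e).
Proof.
move=> He; have Hc := numbered_containsP G He; have Hi := has_inducedP H G.
by split=> nH; [move/Hc/Hi|move/Hi/Hc].
Qed.

(** * The five obstructions *)

Definition symcl (e : rel nat) : rel nat :=
  fun i j => (i != j) && (e i j || e j i).

Lemma numbered_of_rel (T : finType) (r : rel T) n e (enc : T -> nat) :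
  numbering n enc -> (forall x y, r x y = e (enc x) (enc y)) ->
  @numbered (of_rel r) n (symcl e) enc.
Proof.
move=> nT rE; split=> // x y; rewrite /= /of_rel_adj /symcl !rE.
by case: nT => dec [/can_inj/inj_eq->].
Qed.

Lemma numbering_ord n : numbering n.+1 (@nat_of_ord n.+1).
Proof.
exists inord; split=> [i|i|i lti]; first exact: inord_val.
- exact: ltn_ord.
- exact: inordK.
Qed.

Lemma numbering_option (T : Type) n (enc : T -> nat) :
  numbering n enc -> numbering n.+1 (oapp enc n).
Proof.
case=> dec [encK encn decK].
exists (fun i => if i == n then None else Some (dec i)); split=> [[x|]|[x|]|i] //=.
- by rewrite ltn_eqF // encK.
- by rewrite eqxx.
- exact/ltnW/encn.
- by rewrite ltnS; case: ltngtP => //= lti _; apply: decK.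
Qed.

(** Counterpart of [add_vertex], with the new vertex numbered [n]. *)
Definition cone n (e : rel nat) (N : pred nat) : rel nat :=
  symcl (fun i j => if j == n then false else if i == n then N j else e i j).

Lemma numbered_add_vertex (G : sgraph) n e (enc : G -> nat) (N : pred G) Nn :
  numbered n e enc -> (forall x, N x = Nn (enc x)) ->
  @numbered (add_vertex N) n.+1 (cone n e Nn) (oapp enc n).
Proof.
case=> nG eE NE; apply: numbered_of_rel; first exact: numbering_option.
have encn x : (enc x == n) = false by case: nG => dec [_ /(_ x) ltx _]; rewrite ltn_eqF.
by move=> [x|] [y|] /=; rewrite ?eqxx ?encn.
Qed.

Definition edgeless_rel : rel nat := symcl (fun _ _ => false).

Lemma numbered_edgeless n :
  @numbered (edgeless n.+1) n.+1 edgeless_rel (@nat_of_ord n.+1).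
Proof. exact/numbered_of_rel/(fun _ _ => erefl)/numbering_ord. Qed.

Definition path_rel : rel nat := symcl (fun i j => j == i.+1).

Lemma numbered_path n :
  @numbered (path_graph n.+1) n.+1 path_rel (@nat_of_ord n.+1).
Proof. exact/numbered_of_rel/(fun _ _ => erefl)/numbering_ord. Qed.

Definition cycle_rel n : rel nat := symcl (fun i j => j == i.+1 %% n).

Lemma numbered_cycle n :
  @numbered (cycle_graph n.+1) n.+1 (cycle_rel n.+1) (@nat_of_ord n.+1).
Proof. exact/numbered_of_rel/(fun _ _ => erefl)/numbering_ord. Qed.

Lemma numbered_compl (G : sgraph) n e (enc : G -> nat) :
  numbered n e enc ->
  @numbered (compl_graph G) n (symcl (fun i j => ~~ e i j)) enc.
Proof. by case=> nG eE; apply: numbered_of_rel => // x y; rewrite eE. Qed.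

Definition K13_rel := cone 3 edgeless_rel predT.
Definition W4_rel := cone 4 (cycle_rel 4) predT.
Definition bull_rel :=
  symcl (fun i j => path_rel i j || (i == 1) && (j == 3)).
Definition coBW3_rel :=
  symcl (fun i j => ~~ cone 6 (cycle_rel 6) (fun i => ~~ odd i) i j).

Lemma numbered_K13 : @numbered K13 4 K13_rel (oapp val 3).
Proof. exact/(numbered_add_vertex (numbered_edgeless 2)). Qed.

Lemma numbered_W4 : @numbered W4 5 W4_rel (oapp val 4).
Proof. exact/(numbered_add_vertex (numbered_cycle 3)). Qed.

Lemma numbered_bull : @numbered bull 5 bull_rel val.
Proof. exact/numbered_of_rel/(fun _ _ => erefl)/numbering_ord. Qed.

Lemma numbered_coBW3 : @numbered coBW3 7 coBW3_rel (oapp val 6).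
Proof. exact/numbered_compl/(numbered_add_vertex (numbered_cycle 5)). Qed.

(** The target graph comes first and sizes never decrease, so small obstructions prune the checks of
    larger ones. *)
Definition fam_3P1 :=
  [:: tab 3 edgeless_rel; tab 5 W4_rel; tab 7 coBW3_rel].

Definition fam_K13 :=
  [:: tab 4 K13_rel; tab 5 path_rel; tab 5 bull_rel; tab 5 W4_rel;
      tab 7 coBW3_rel].

Lemma chain_3P1 : chain fam_3P1 [::] fam_3P1.
Proof. by vm_compute. Qed.

Lemma chain_K13 : chain fam_K13 [::] fam_K13.
Proof. by vm_compute. Qed.

(* Pivot sequences leading to 3P_1 or K_{1,3}; for instance the last one is for
   the complement of BW_3. *)
Definition certificates : seq (seq (nat * nat)) :=
  [:: [::]; [:: (1, 0)]; [:: (2, 1)]; [:: (4, 0)]; [:: (2, 0); (3, 1)]].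

Theorem theorem7p1 :
  (forall G : sgraph,
     pivot_minor_free threeP1 G <->
     [/\ induced_free threeP1 G, induced_free W4 G & induced_free coBW3 G])
  /\
  (forall G : sgraph,
     pivot_minor_free K13 G <->
     [/\ induced_free K13 G, induced_free P5 G, induced_free bull G,
         induced_free W4 G & induced_free coBW3 G]).
Proof.
have f3 G := induced_freeP G (numbered_edgeless 2).
have fK G := induced_freeP G numbered_K13.
have fP G := induced_freeP G (numbered_path 4).
have fB G := induced_freeP G numbered_bull.
have fW G := induced_freeP G numbered_W4.
have fC G := induced_freeP G numbered_coBW3.
split=> G.
  (* The argument [isT] settles by evaluation that each obstruction has a working certificate. *)
  have char := @pivot_minor_free_family _ _ _ _ fam_3P1 certificates
    (numbered_edgeless 2) (mem_head _ _) chain_3P1 isT G.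
  split=> [/char fr|[/f3 n3 /fW nW /fC nC]].
    by split; [apply/f3|apply/fW|apply/fC]; apply: fr; rewrite !inE eqxx ?orbT.
  by apply/char=> E; rewrite !inE => /or3P[] /eqP->.
have char := @pivot_minor_free_family _ _ _ _ fam_K13 certificates
  numbered_K13 (mem_head _ _) chain_K13 isT G.
split=> [/char fr|[/fK nK /fP nP /fB nB /fW nW /fC nC]].
  by split; [apply/fK|apply/fP|apply/fB|apply/fW|apply/fC];
    apply: fr; rewrite !inE eqxx ?orbT.
by apply/char=> E; rewrite !inE => /or4P[| | |/orP[]] /eqP->.
Qed.
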